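(* Let $\mathcal{U}=PC(\mathbb{R}_+,U)$ and let $\Sigma=(X,\mathcal{U},\phi)$ be a time-varying control system satisfying the BIC property. (a) If there exists a coercive iISS Lyapunov function for $\Sigma$, then $\Sigma$ is forward complete and iISS. (b) If there exists a coercive ISS Lyapunov function in dissipative form for $\Sigma$, then $\Sigma$ is ISS.
   Context: Comparison classes: $\mathcal{P}$ (continuous, zero at $0$, positive elsewhere), $\mathcal{K}$ (strictly increasing members of $\mathcal{P}$), $\mathcal{K}_\infty$ (unbounded members of $\mathcal{K}$), $\mathcal{KL}$ (continuous $\beta$ with $\beta(\cdot,t)\in\mathcal{K}$ and $\beta(r,\cdot)$ continuous, strictly decreasing to $0$ for $r>0$). $PC(\mathbb{R}_+,U)$ is the space of globally bounded, right-continuous, piecewise continuous functions $\mathbb{R}_+\to U$ (discontinuities without accumulation points), with norm $\|u\|_{\mathcal{U}}=\sup_{s\ge0}\|u(s)\|_U$. Control system. $\Sigma=(X,\mathcal{U},\phi)$ consists of a normed space $X$, an input space $\mathcal{U}$ of functions $\mathbb{R}_+\to U$ that is shift-invariant with $\|u(\cdot+\tau)\|_{\mathcal{U}}\le\|u\|_{\mathcal{U}}$, and a map $\phi(t,t_0,x_0,u)$ defined for $t\in[t_0,t_m(t_0,x_0,u))$ with $t_m\in(t_0,\infty]$. It satisfies: - identity: $\phi(t_0,t_0,x_0,u)=x_0$; - causality: $\phi(t,t_0,x_0,u)$ depends only on $u|_{[t_0,t)}$; - continuity in $t$; - cocycle: $\phi(t,\tau,\phi(\tau,t_0,x_0,u),u)=\phi(t,t_0,x_0,u)$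 for $t_0\le\tau\le t<t_m$. The system is forward complete if $t_m=\infty$ always. BIC: whenever $t_m<\infty$, the trajectory is unbounded on $[t_0,t_m)$. Lie derivative: $\dot V_u(t,x)=\limsup_{h\to0^+}\frac1h\big(V(t+h,\phi(t+h,t,x,u))-V(t,x)\big)$. Coercive iISS Lyapunov function. A continuous $V:\mathbb{R}_+\times X\to\mathbb{R}_+$ with $V(t,0)=0$ for which there exist $\alpha_1,\alpha_2\in\mathcal{K}_\infty$, $\eta\in\mathcal{P}$ and $\chi\in\mathcal{K}$ such that: - $\alpha_1(\|x\|_X)\le V(t,x)\le\alpha_2(\|x\|_X)$ for all $t\ge0$ and $x\in X$; - $\dot V_u(t,x)\le-\eta(\|x\|_X)+\chi(\|u(t)\|_U)$ for all $x\in X$, $u\in\mathcal{U}$ and $t\ge0$. If in addition $\lim_{\tau\to\infty}\eta(\tau)=\infty$ or $\liminf_{\tau\to\infty}\eta(\tau)\ge\lim_{\tau\to\infty}\chi(\tau)$, then $V$ is a coercive ISS Lyapunov function in dissipative form. iISS. $\Sigma$ (forward complete, with $\mathcal{U}=PC(\mathbb{R}_+,U)$) is iISS if there exist $\alpha\in\mathcal{K}_\infty$, $\mu\in\mathcal{K}$ and $\beta\in\mathcal{KL}$ such that for all $x_0$, $u$ and $t\ge t_0\ge0$: $$\|\phi(t,t_0,x_0,u)\|_X\le\beta(\|x_0\|_X,t-t_0)+\alpha\Big(\int_{t_0}^t\mu(\|u(s)\|_U)\,ds\Big).$$ ISS. There exist $\beta\in\mathcal{KL}$ and $\gamma\in\mathcal{K}$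 such that all trajectories exist on $[t_0,\infty)$ and $$\|\phi(t,t_0,x_0,u)\|_X\le\beta(\|x_0\|_X,t-t_0)+\gamma(\|u\|_{\mathcal{U}}).$$ *)

(* Defs.v *)
From HB Require Import structures.
From mathcomp Require Import all_boot all_order all_algebra.
From mathcomp Require Import all_classical all_reals all_analysis.
Set Implicit Arguments. Unset Strict Implicit. Unset Printing Implicit Defensive.
Import Order.TTheory GRing.Theory Num.Theory.
Import numFieldNormedType.Exports.
Local Open Scope classical_set_scope.
Local Open Scope ring_scope.

Section Defs.
Variable R : realType.

Definition class_P (f : R -> R) : Prop :=
  {within `[0, +oo[, continuous f} /\ f 0 = 0 /\ (forall r, 0 < r -> 0 < f r).

Definition class_K (f : R -> R) : Prop :=
  class_P f /\ {in `[0, +oo[ &, {mono f : x y / x < y}}.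

Definition class_Kinf (f : R -> R) : Prop :=
  class_K f /\ (forall M, exists r, 0 <= r /\ M < f r).

Definition class_KL (b : R -> R -> R) : Prop :=
  {within [set p : R * R | 0 <= p.1 /\ 0 <= p.2], continuous (fun p => b p.1 p.2)} /\
  (forall t, 0 <= t -> class_K (b ^~ t)) /\
  (forall r, 0 < r ->
     {within `[0, +oo[, continuous (b r)} /\
     {in `[0, +oo[ &, {mono b r : x y /~ x < y}} /\
     b r x @[x --> +oo%R] --> 0).

Variable U : normedModType R.

(* Inputs are functions R -> U; only their values on [0,+oo[ matter. *)
Definition PC (u : R -> U) : Prop :=
  (exists M : R, forall s, 0 <= s -> `|u s| <= M) /\
  (forall s, 0 <= s -> u x @[x --> s^'+] --> u s) /\
  (forall s, 0 < s -> cvg (u x @[x --> s^'-])) /\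
  (forall T : R, finite_set [set s : R | 0 < s <= T /\ ~ (u x @[x --> s] --> u s)]).

Definition normPC (u : R -> U) : R := sup [set `|u s| | s in `[0, +oo[].

Variable X : normedModType R.

(* phi t t0 x0 u : state at time t; tm t0 x0 u : maximal existence time *)
Definition control_system
  (phi : R -> R -> X -> (R -> U) -> X) (tm : R -> X -> (R -> U) -> \bar R) : Prop :=
  forall t0 x0 u, 0 <= t0 -> PC u ->
    (t0%:E < tm t0 x0 u)%E /\
    phi t0 t0 x0 u = x0 /\
    (forall t v, PC v -> t0 <= t -> (t%:E < tm t0 x0 u)%E ->
       (forall s, t0 <= s < t -> u s = v s) ->
       (t%:E < tm t0 x0 v)%E /\ phi t t0 x0 u = phi t t0 x0 v) /\
    {within [set t | t0 <= t /\ (t%:E < tm t0 x0 u)%E], continuous (fun t => phi t t0 x0 u)} /\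
    (forall tau t, t0 <= tau <= t -> (t%:E < tm t0 x0 u)%E ->
       (t%:E < tm tau (phi tau t0 x0 u) u)%E /\
       phi t tau (phi tau t0 x0 u) u = phi t t0 x0 u).

Definition forward_complete (phi : R -> R -> X -> (R -> U) -> X) (tm : R -> X -> (R -> U) -> \bar R) : Prop :=
  forall t0 x0 u, 0 <= t0 -> PC u -> tm t0 x0 u = +oo%E.

Definition BIC (phi : R -> R -> X -> (R -> U) -> X) (tm : R -> X -> (R -> U) -> \bar R) : Prop :=
  forall t0 x0 u, 0 <= t0 -> PC u -> (tm t0 x0 u < +oo)%E ->
    ~ (exists M : R, forall t, t0 <= t -> (t%:E < tm t0 x0 u)%E ->
         `|phi t t0 x0 u : X| <= M).

Definition lie_derivative (phi : R -> R -> X -> (R -> U) -> X)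
  (V : R -> X -> R) (u : R -> U) (t : R) (x : X) : \bar R :=
  limf_esup (fun h : R => ((V (t + h) (phi (t + h) t x u) - V t x) / h)%:E) (0^'+).

Definition coercive_iISS_LF (phi : R -> R -> X -> (R -> U) -> X) (V : R -> X -> R)
  (a1 a2 eta chi : R -> R) : Prop :=
  {within [set p : R * X | 0 <= p.1], continuous (fun p => V p.1 p.2)} /\
  (forall t x, 0 <= t -> 0 <= V t x) /\
  (forall t, 0 <= t -> V t 0 = 0) /\
  class_Kinf a1 /\ class_Kinf a2 /\ class_P eta /\ class_K chi /\
  (forall t x, 0 <= t -> a1 `|x| <= V t x <= a2 `|x|) /\
  (forall t x u, 0 <= t -> PC u ->
     (lie_derivative phi V u t x <= (- eta `|x| + chi `|u t|)%:E)%E).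

Definition has_coercive_iISS_LF (phi : R -> R -> X -> (R -> U) -> X) : Prop :=
  exists V a1 a2 eta chi, coercive_iISS_LF phi V a1 a2 eta chi.

Definition has_coercive_ISS_LF_dissipative (phi : R -> R -> X -> (R -> U) -> X) : Prop :=
  exists V a1 a2 eta chi, coercive_iISS_LF phi V a1 a2 eta chi /\
    ((eta x)%:E @[x --> +oo%R] --> +oo%E \/
     (lim ((chi x)%:E @[x --> +oo%R]) <= limf_einf (fun x : R => (eta x)%:E) (+oo%R : set_system R))%E).

Definition iISS (phi : R -> R -> X -> (R -> U) -> X) (tm : R -> X -> (R -> U) -> \bar R) : Prop :=
  forward_complete phi tm /\
  exists (alpha mu : R -> R) (beta : R -> R -> R),
    class_Kinf alpha /\ class_K mu /\ class_KL beta /\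
    forall t0 x0 u t, 0 <= t0 -> PC u -> t0 <= t ->
      `|phi t t0 x0 u| <= beta `|x0| (t - t0) +
        alpha (Rintegral lebesgue_measure `[t0, t] (fun s => mu `|u s|)).

Definition ISS (phi : R -> R -> X -> (R -> U) -> X) (tm : R -> X -> (R -> U) -> \bar R) : Prop :=
  forward_complete phi tm /\
  exists (beta : R -> R -> R) (gamma : R -> R),
    class_KL beta /\ class_K gamma /\
    forall t0 x0 u t, 0 <= t0 -> PC u -> t0 <= t ->
      `|phi t t0 x0 u| <= beta `|x0| (t - t0) + gamma (normPC u).

End Defs.

(* Main.v *)
Require Import Defs.
From HB Require Import structures.
From mathcomp Require Import all_boot all_order all_algebra.
From mathcomp Require Import all_classical all_reals all_analysis.
From mathcomp Require Import lra ring.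

(** Along a trajectory, y(t) = V(t, x(t)) has upper right Dini derivative at most
    -eta(|x|) + chi(|u|); hence y grows at most linearly on bounded intervals
    and BIC yields forward completeness. A function that decays at rate at
    least m while it stays above a level a2(p) satisfies a2(p) + T m <= y(t0);
    taking for m a continuous minorant of eta on the band of state norms in
    which the trajectory is confined and solving this inequality for p gives a
    KL function directly, without any comparison ODE. For iISS this is applied
    to y minus the integral of chi(|u|); for ISS, a gain rho is chosen so that
    -eta(r) + chi(N) <= -eta'(r) for r >= rho(N), with eta' independent of N,
    and it is applied to y as long as y exceeds a2(rho(N)). *)

Set Implicit Arguments. Unset Strict Implicit. Unset Printing Implicit Defensive.
Import Order.TTheory GRing.Theory Num.Theory.
Import numFieldNormedType.Exports.
Local Open Scope classical_set_scope.
Local Open Scope ring_scope.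

(** * Relative continuity and continuity of implicitly defined roots *)

Section Continuity.
Variable R : realType.

Lemma within_continuous_comp_sub (S T W : topologicalType) (A : set S)
    (B : set T) (f : S -> T) (g : T -> W) :
  (forall x, A x -> B (f x)) -> {within A, continuous f} ->
  {within B, continuous g} -> {within A, continuous (g \o f)}.
Proof.
move=> AB /subspace_continuousP fc /subspace_continuousP gc.
apply/subspace_continuousP => x Ax N /= gN.
have /= := gc (f x) (AB x Ax) N gN; rewrite /within /= => fN.
have := fc x Ax _ fN; rewrite /within /= /nbhs /= /within /=.
by apply: filterS => y Py Ay; apply: Py => //; exact: AB.
Qed.

Lemma within_continuous_distP (T : topologicalType) (A : set T) (f : T -> R) :
  (forall x, A x -> forall e, 0 < e ->
     \forall y \near x, A y -> `|f x - f y| < e) <-> {within A, continuous f}.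
Proof.
split=> [H|/subspace_continuousP H].
  apply/subspace_continuousP => x Ax; apply/cvgrPdist_lt => e e0.
  exact: H.
by move=> x Ax e e0; have /cvgrPdist_lt /(_ e e0) := H x Ax.
Qed.

(** The signs of [H] at [p w - e] and [p w + e] are strict, so they persist at nearby parameters,
    and strict monotonicity in the first argument then traps the root between these two values. When
    [p w - e] is negative, nonnegativity of [p] replaces the lower half. *)
Lemma root_within_continuous (W : topologicalType) (D : set W)
    (H : R -> W -> R) (p : W -> R) :
  (forall w, D w -> 0 <= p w) -> (forall w, D w -> H (p w) w = 0) ->
  (forall w, D w -> forall x y, 0 <= x -> x < y -> H x w < H y w) ->
  (forall x, 0 <= x -> {within D, continuous (H x)}) ->
  {within D, continuous p}.
Proof.
move=> p0 Hp0 Hlt Hc; apply/within_continuous_distP => w Dw e e0.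
have le_root v x : D v -> 0 <= x -> 0 < H x v -> p v < x.
  move=> Dv x0 Hx; rewrite ltNge; apply/negP; rewrite le_eqVlt => /orP[/eqP xp|xp].
    by move: Hx; rewrite xp Hp0 ?ltxx.
  by have := Hlt v Dv _ _ x0 xp; rewrite Hp0 // ltNge (ltW Hx).
have ge_root v x : D v -> H x v < 0 -> x < p v.
  move=> Dv Hx; rewrite ltNge; apply/negP; rewrite le_eqVlt => /orP[/eqP xp|xp].
    by move: Hx; rewrite -xp Hp0 ?ltxx.
  by have := Hlt v Dv _ _ (p0 v Dv) xp; rewrite Hp0 // ltNge (ltW Hx).
have pe0 : 0 <= p w + e by have := p0 w Dw; lra.
have up : \forall v \near w, D v -> p v < p w + e.
  have Hpos : 0 < H (p w + e) w.
    by rewrite -(Hp0 w Dw); apply: Hlt => //; [exact: p0|lra].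
  have /within_continuous_distP /(_ w Dw _ Hpos) := Hc _ pe0.
  apply: filterS => v Hv Dv; apply: le_root => //.
  by have := Hv Dv; rewrite ltr_norml => /andP[_]; lra.
have dn : \forall v \near w, D v -> p w - e < p v.
  have [pe|pe] := ltP (p w - e) 0.
    by apply: filterE => v Dv; have := p0 v Dv; lra.
  have Hneg : 0 < - H (p w - e) w.
    by rewrite oppr_gt0 -(Hp0 w Dw); apply: Hlt => //; lra.
  have /within_continuous_distP /(_ w Dw _ Hneg) := Hc _ pe.
  apply: filterS => v Hv Dv; apply: ge_root => //.
  by have := Hv Dv; rewrite ltr_norml => /andP[]; lra.
move: up dn; apply: filterS2 => v up dn Dv.
by rewrite ltr_norml; apply/andP; have := up Dv; have := dn Dv; split; lra.
Qed.

Lemma within_continuousM (T : topologicalType) (A : set T) (f g : T -> R) :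
  {within A, continuous f} -> {within A, continuous g} ->
  {within A, continuous (fun x => f x * g x)}.
Proof.
move=> /subspace_continuousP fc /subspace_continuousP gc.
by apply/subspace_continuousP => x Ax; apply: cvgM; [exact: fc|exact: gc].
Qed.

Lemma within_continuous_lipschitz (A : set R) (f : R -> R) :
  (forall x y, `|f x - f y| <= `|x - y|) -> {within A, continuous f}.
Proof.
move=> fL; apply/within_continuous_distP => x Ax e e0.
exists e => //= y /= xy _; exact: le_lt_trans (fL _ _) xy.
Qed.

Lemma ge0_root (f : R -> R) (b c : R) :
  0 <= b -> {within `[0, +oo[, continuous f} -> f 0 <= c -> c <= f b ->
  exists p, 0 <= p <= b /\ f p = c.
Proof.
move=> b0 fc f0 fb.
have fc' : {within `[0, b], continuous f}.
  by apply: continuous_subspaceW fc => x /=; rewrite !in_itv /= andbT => /andP[].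
have [|p] := IVT b0 fc' (v := c).
  by rewrite ge_min f0 le_max fb orbT.
by rewrite in_itv /= => ? <-; exists p.
Qed.

Lemma strict_homo_mono (f : R -> R) :
  (forall x y, 0 <= x -> x < y -> f x < f y) ->
  {in `[0, +oo[ &, {mono f : x y / x < y}}.
Proof.
move=> H; apply/leW_mono_in/le_mono_in => x y.
by rewrite !in_itv /= !andbT => x0 _; exact: H.
Qed.

End Continuity.

(** * Comparison functions of class K and their inverses *)

Section ClassK.
Variable R : realType.
Implicit Types f g : R -> R.

Lemma class_KI f : {within `[0, +oo[, continuous f} -> f 0 = 0 ->
  (forall x y, 0 <= x -> x < y -> f x < f y) -> class_K f.
Proof.
move=> fc f0 flt; split; last exact: strict_homo_mono.
by split=> //; split=> // r r0; rewrite -f0; exact: flt.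
Qed.

Lemma class_K_lt f x y : class_K f -> 0 <= x -> x < y -> f x < f y.
Proof.
move=> [_ fm] x0 xy; rewrite fm // in_itv /= andbT //.
by rewrite (le_trans x0) ?ltW.
Qed.

Lemma class_K_le f x y : class_K f -> 0 <= x -> x <= y -> f x <= f y.
Proof.
move=> fK x0; rewrite le_eqVlt => /orP[/eqP->//|xy].
exact/ltW/class_K_lt.
Qed.

Lemma class_K0 f : class_K f -> f 0 = 0. Proof. by case=> -[_ []]. Qed.

Lemma class_Kc f : class_K f -> {within `[0, +oo[, continuous f}.
Proof. by case=> -[]. Qed.

Lemma class_P_ge0 f x : class_P f -> 0 <= x -> 0 <= f x.
Proof.
by move=> [_ [f0 fp]]; rewrite le_eqVlt => /orP[/eqP<-|/fp/ltW//]; rewrite f0.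
Qed.

Lemma class_K_ge0 f x : class_K f -> 0 <= x -> 0 <= f x.
Proof. by case=> fP _; exact: class_P_ge0. Qed.

Lemma class_K_leI f x y : class_K f -> 0 <= y -> f x <= f y -> x <= y.
Proof.
by move=> fK y0; rewrite !leNgt; apply: contra => yx; exact: class_K_lt.
Qed.

Lemma class_K_scale (k : R) : 0 < k -> class_K (fun x => k * x).
Proof.
move=> k0; apply: class_KI => [||x y _ xy]; last by rewrite ltr_pM2l.
  apply: continuous_subspaceT => x; exact: mulrl_continuous.
by rewrite mulr0.
Qed.

Lemma class_K_comp f g : class_K f -> class_K g -> class_K (f \o g).
Proof.
move=> fK gK; apply: class_KI => /= [||x y x0 xy].
- apply: within_continuous_comp_sub (class_Kc gK) (class_Kc fK) => x /=.
  by rewrite !in_itv /= !andbT; exact: class_K_ge0.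
- by rewrite (class_K0 gK) (class_K0 fK).
- by apply: class_K_lt => //; [exact: class_K_ge0|exact: class_K_lt].
Qed.

(** [h] is the inverse of [f] composed with [g]; the range of [f] has only to cover that of [g], so
    [f] may be bounded. With [g] the identity it inverts an unbounded [f], and in [dissipation_gain]
    it produces the gain. *)
Lemma class_K_root f g : class_K f -> class_K g ->
  (forall x, 0 <= x -> exists2 r, 0 <= r & g x <= f r) ->
  exists2 h, class_K h & forall x, 0 <= x -> 0 <= h x /\ f (h x) = g x.
Proof.
move=> fK gK fg.
have /choice[h hE] : forall x, exists p, 0 <= x -> 0 <= p /\ f p = g x.
  move=> x; have [x0|x0] := leP 0 x; last by exists 0 => ?; lra.
  have [r r0 gr] := fg x x0.
  have [||p [/andP[p0 _] fp]] := @ge0_root _ f r (g x) r0 (class_Kc fK) => //.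
    by rewrite (class_K0 fK) class_K_ge0.
  by exists p.
exists h => //; apply: class_KI => [||x y x0 xy].
- apply: (@root_within_continuous _ _ _ (fun p x => f p - g x)) => /=.
  + by move=> x; rewrite in_itv /= andbT => /hE[].
  + by move=> x; rewrite in_itv /= andbT => /hE[_ ->]; rewrite subrr.
  + by move=> x _ p q p0 pq; have := class_K_lt fK p0 pq; lra.
  + move=> p p0; apply: within_continuousB (class_Kc gK).
    by apply: continuous_subspaceT => ?; exact: cvg_cst.
- have [h0 fh0] := hE 0 (lexx 0).
  apply/eqP; rewrite eq_le h0 andbT; apply: (class_K_leI fK) => //.
  by rewrite fh0 (class_K0 fK) (class_K0 gK).
- have y0 : 0 <= y by lra.
  rewrite ltNge; apply/negP => hyx.
  have := class_K_le fK (hE y y0).1 hyx.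
  by rewrite (hE y y0).2 (hE x x0).2 leNgt (class_K_lt gK).
Qed.

Lemma class_Kinf_inv f : class_Kinf f ->
  exists2 g, class_Kinf g & forall y, 0 <= y -> 0 <= g y /\ f (g y) = y.
Proof.
move=> [fK finf].
have idK : class_K (fun x : R => 1 * x) by exact: class_K_scale.
have [x x0|g gK gE] := class_K_root fK idK.
  by have [r [r0 fr]] := finf (1 * x); exists r => //; exact: ltW.
have fgE y : 0 <= y -> 0 <= g y /\ f (g y) = y.
  by move=> /gE; rewrite mul1r.
exists g => //; split => // M.
exists (f (`|M| + 1)); split; first by apply: class_K_ge0.
have f0 : 0 <= f (`|M| + 1) by apply: class_K_ge0.
have [g0 fg] := fgE _ f0.
suff : `|M| + 1 <= g (f (`|M| + 1)) by have := ler_norm M; lra.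
by apply: (class_K_leI fK g0); rewrite fg.
Qed.

End ClassK.

(** * Lipschitz minorants of a positive definite function *)

Section Envelope.
Variables (R : realType) (eta : R -> R).
Hypothesis etaP : class_P eta.
Implicit Types f g : R -> R.

(** A penalty [f] in place of a constraint on [r], as in a Pasch-Hausdorff envelope: the infimum
    then depends in a Lipschitz way on the endpoints that enter [f]. *)
Definition penalized_inf f : R :=
  inf [set eta r + f r | r in [set r | 0 <= r]].

Lemma penalized_inf_le f r : (forall x, 0 <= f x) -> 0 <= r ->
  penalized_inf f <= eta r + f r.
Proof.
move=> f0 r0; apply: ge_inf; last by exists r.
by exists 0 => _ [x /= x0 <-]; rewrite addr_ge0 ?(class_P_ge0 etaP).
Qed.

Lemma penalized_inf_ge f c : (forall r, 0 <= r -> c <= eta r + f r) ->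
  c <= penalized_inf f.
Proof.
move=> H; apply: lb_le_inf; first by exists (eta 0 + f 0), 0 => /=.
by move=> _ [r /= r0 <-]; exact: H.
Qed.

Lemma penalized_inf_ge0 f : (forall x, 0 <= f x) -> 0 <= penalized_inf f.
Proof.
by move=> f0; apply: penalized_inf_ge => r r0; rewrite addr_ge0 ?(class_P_ge0 etaP).
Qed.

(** Source of both regularity properties of the envelopes: [d = 0] gives monotonicity, and [d] equal
    to the displacement of an endpoint gives the Lipschitz bounds. *)
Lemma penalized_inf_leD f g d : (forall x, 0 <= f x) ->
  (forall x, 0 <= x -> f x <= g x + d) ->
  penalized_inf f <= penalized_inf g + d.
Proof.
move=> f0 fg; rewrite -lerBlDr; apply: penalized_inf_ge => r r0.
by have := penalized_inf_le f0 r0; have := fg r r0; lra.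
Qed.

(* A 1-Lipschitz minorant of the infimum of eta over [p, q] ([tail_inf]: over
   [p, +oo[), which is still positive for p > 0. *)
Definition band_inf p q := penalized_inf
  (fun r => Num.max (p - r) 0 + Num.max (r - q) 0).

Definition tail_inf p := penalized_inf (fun r => Num.max (p - r) 0).

Let band_ge0 p q x : 0 <= Num.max (p - x) 0 + Num.max (x - q) 0 :> R.
Proof. by rewrite addr_ge0 ?le_max ?lexx ?orbT. Qed.

Let tail_ge0 p x : 0 <= Num.max (p - x) 0 :> R.
Proof. by rewrite le_max lexx orbT. Qed.

Lemma band_inf_ge0 p q : 0 <= band_inf p q.
Proof. exact: penalized_inf_ge0. Qed.

Lemma tail_inf_ge0 p : 0 <= tail_inf p.
Proof. exact: penalized_inf_ge0. Qed.

Lemma band_inf_le p q r : 0 <= r -> p <= r <= q -> band_inf p q <= eta r.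
Proof.
move=> r0 /andP[pr rq]; apply: le_trans (penalized_inf_le _ r0) _ => //.
by rewrite !max_r ?subr_le0 // !addr0.
Qed.

Lemma tail_inf_le p r : 0 <= r -> p <= r -> tail_inf p <= eta r.
Proof.
move=> r0 pr; apply: le_trans (penalized_inf_le _ r0) _ => //.
by rewrite !max_r ?subr_le0 // !addr0.
Qed.

Lemma band_inf0 q : 0 <= q -> band_inf 0 q = 0.
Proof.
move=> q0; apply/eqP; rewrite eq_le band_inf_ge0 andbT.
by case: etaP => _ [e0 _]; rewrite -[leRHS]e0; apply: band_inf_le; rewrite ?lexx.
Qed.

Lemma tail_inf0 : tail_inf 0 = 0.
Proof.
apply/eqP; rewrite eq_le tail_inf_ge0 andbT.
by case: etaP => _ [e0 _]; rewrite -[leRHS]e0; apply: tail_inf_le; rewrite ?lexx.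
Qed.

Lemma maxB_le (x y : R) : Num.max x 0 <= Num.max y 0 + Num.max (x - y) 0.
Proof.
have := le_max y y 0; have := le_max (x - y) (x - y) 0.
have := le_max 0 y 0; have := le_max 0 (x - y) 0.
rewrite !lexx !orbT /= ge_max => ? ? ? ?; apply/andP; split; lra.
Qed.

Lemma band_inf_homo p p' q q' : p <= p' -> q' <= q ->
  band_inf p q <= band_inf p' q'.
Proof.
move=> pp qq; rewrite -[leRHS]addr0; apply: penalized_inf_leD => // x x0.
by rewrite addr0 lerD // le_max2 // lerB.
Qed.

Lemma tail_inf_homo p p' : p <= p' -> tail_inf p <= tail_inf p'.
Proof.
move=> pp; rewrite -[leRHS]addr0; apply: penalized_inf_leD => // x x0.
by rewrite addr0 // le_max2 // lerB.
Qed.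

Let max_le_dist (x y z : R) : z = x - y -> Num.max z 0 <= `|x - y|.
Proof. by move=> ->; rewrite ge_max ler_norm normr_ge0. Qed.

Let lipschitz_abs (f : R -> R) :
  (forall x y, f x <= f y + `|x - y|) -> forall x y, `|f x - f y| <= `|x - y|.
Proof.
move=> H x y; rewrite ler_norml; apply/andP.
by have := H x y; have := H y x; rewrite (distrC y x); split; lra.
Qed.

Lemma band_inf_lipschitzl q p p' :
  `|band_inf p q - band_inf p' q| <= `|p - p'|.
Proof.
apply: (lipschitz_abs (f := band_inf ^~ q)) => {}p {}p' /=.
apply: penalized_inf_leD => // x x0; rewrite addrAC lerD //.
apply: (le_trans (maxB_le _ (p' - x))); rewrite lerD //.
by apply: max_le_dist; ring.
Qed.

Lemma band_inf_lipschitzr p q q' :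
  `|band_inf p q - band_inf p q'| <= `|q - q'|.
Proof.
apply: (lipschitz_abs (f := band_inf p)) => {}q {}q' /=.
apply: penalized_inf_leD => // x x0; rewrite -addrA lerD //.
apply: (le_trans (maxB_le _ (x - q'))); rewrite lerD // (distrC q).
by apply: max_le_dist; ring.
Qed.

Lemma tail_inf_lipschitz p p' : `|tail_inf p - tail_inf p'| <= `|p - p'|.
Proof.
apply: (lipschitz_abs (f := tail_inf)) => {}p {}p' /=.
apply: penalized_inf_leD => // x x0.
apply: (le_trans (maxB_le _ (p' - x))); rewrite lerD //.
by apply: max_le_dist; ring.
Qed.

Lemma class_P_itv_lb (a b : R) : 0 < a ->
  exists2 m, 0 < m & forall r, a <= r <= b -> m <= eta r.
Proof.
move=> a0; have [ba|ab] := ltP b a; first by exists 1 => // r /andP[]; lra.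
case: etaP => ec [_ ep].
have ec' : {within `[a, b], continuous eta}.
  apply: continuous_subspaceW ec => x /=; rewrite !in_itv /= andbT => /andP[]; lra.
have [c + cmin] := EVT_min ab ec'.
rewrite in_itv /= => /andP[ac cb].
exists (eta c) => [|r rab]; first by apply: ep; lra.
by apply: cmin; rewrite in_itv.
Qed.

(** Three zones: below [p / 2] the penalty is at least [p / 2], above [q + 1] it is at least 1, and
    in between compactness bounds [eta] below by a positive [m]. *)
Lemma band_inf_gt0 p q : 0 < p -> 0 < band_inf p q.
Proof.
move=> p0; have p20 : 0 < p / 2 by rewrite divr_gt0.
have [m m0 mle] := class_P_itv_lb (q + 1) p20.
apply: (@lt_le_trans _ _ (Num.min m (Num.min (p / 2) 1))).
  by rewrite !lt_min m0 p20 ltr01.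
apply: penalized_inf_ge => r r0.
have er := class_P_ge0 etaP r0.
have [rp|pr] := ltP r (p / 2).
  rewrite ge_min; apply/orP; right; rewrite ge_min; apply/orP; left.
  have : p - r <= Num.max (p - r) 0 by rewrite le_max lexx.
  have : 0 <= Num.max (r - q) 0 by rewrite le_max lexx orbT.
  lra.
have [rq|qr] := leP r (q + 1).
  by rewrite ge_min; apply/orP; left; rewrite ler_wpDr // mle // pr rq.
rewrite ge_min; apply/orP; right; rewrite ge_min; apply/orP; right.
have : r - q <= Num.max (r - q) 0 by rewrite le_max lexx.
have := tail_ge0 p r.
lra.
Qed.

(** Points below [a] carry a penalty of at least [p - a], hence of at least [c]. *)
Lemma tail_inf_ge (c a p : R) : 0 <= a -> (forall r, a <= r -> c <= eta r) ->
  a + c <= p -> c <= tail_inf p.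
Proof.
move=> a0 ca acp; apply: penalized_inf_ge => r r0.
have [ra|ar] := leP a r; first by rewrite ler_wpDr // ca.
have := class_P_ge0 etaP r0.
have : p - r <= Num.max (p - r) 0 by rewrite le_max lexx.
lra.
Qed.

(** The compactness argument of [band_inf_gt0] stops at [a]; beyond it the bound [c] takes over,
    since large [r] are not penalized. *)
Lemma tail_inf_gt0 (a c p : R) : 0 < c -> (forall r, a <= r -> c <= eta r) ->
  0 < p -> 0 < tail_inf p.
Proof.
move=> c0 ca p0; have p20 : 0 < p / 2 by rewrite divr_gt0.
have [m m0 mle] := class_P_itv_lb a p20.
apply: (@lt_le_trans _ _ (Num.min (Num.min m c) (p / 2))).
  by rewrite !lt_min m0 p20 c0.
apply: penalized_inf_ge => r r0.
have er := class_P_ge0 etaP r0; have t0 := tail_ge0 p r.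
have [rp|pr] := ltP r (p / 2).
  rewrite ge_min; apply/orP; right.
  have : p - r <= Num.max (p - r) 0 by rewrite le_max lexx.
  lra.
rewrite ge_min; apply/orP; left; rewrite ge_min; apply/orP.
have [ra|ar] := leP a r; first by right; rewrite ler_wpDr // ca.
by left; rewrite ler_wpDr // mle // pr ltW.
Qed.

End Envelope.

(** * Class KL functions defined by an implicit equation *)

Section ClassKL.
Variable R : realType.

Lemma class_KL_comp (f : R -> R) (b : R -> R -> R) :
  class_K f -> class_KL b -> class_KL (fun r t => f (b r t)).
Proof.
move=> fK [bc [bK bL]].
have b0 r t : 0 <= r -> 0 <= t -> 0 <= b r t.
  by move=> r0 t0; apply: (class_K_ge0 (bK t t0)).
split; last split.
- rewrite -[X in {within _, continuous X}]/(f \o (fun p => b p.1 p.2)).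
  apply: (within_continuous_comp_sub _ bc (class_Kc fK)).
  by move=> [r t] /= [r0 t0]; rewrite in_itv /= andbT b0.
- by move=> t t0; exact: class_K_comp (bK t t0).
- move=> r r0; have [rc [rm r_cvg]] := bL r r0; split; last split.
  + rewrite -[X in {within _, continuous X}]/(f \o b r).
    apply: (within_continuous_comp_sub _ rc (class_Kc fK)).
    by move=> t /=; rewrite !in_itv /= !andbT => t0; rewrite b0 // ltW.
  + move=> x y x0 y0; rewrite -(rm _ _ x0 y0).
    move: x0 y0; rewrite !in_itv /= !andbT => x0 y0.
    by case: fK => _ ->//; rewrite in_itv /= andbT b0 // ltW.
  + apply/cvgrPdist_lt => e e0.
    have /within_continuous_distP := class_Kc fK.
    move=> /(_ 0); rewrite /= in_itv /= lexx /= => /(_ isT e e0) [d /= d0 dP].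
    rewrite (class_K0 fK) in dP.
    have /cvgrPdist_lt /(_ d d0) := r_cvg.
    have : \forall t \near +oo%R, (0 : R) <= t by apply: nbhs_pinfty_ge; rewrite real0.
    apply: filterS2 => t t0 bt; apply: dP => //=.
    by rewrite in_itv /= andbT b0 // ltW.
Qed.

(* [beta r t] is the root p of [a p + t * band_inf eta p (Q r) = a r]; since
   the left side is strictly increasing in p and the equation is monotone in r
   and t, all the KL properties are inherited by the root. *)
Lemma class_KL_decay (a Q eta : R -> R) : class_K a -> class_K Q -> class_P eta ->
  exists2 beta, class_KL beta &
    forall r t p, 0 <= r -> 0 <= t -> 0 <= p ->
      a p + t * band_inf eta p (Q r) <= a r -> p <= beta r t.
Proof.
move=> aK QK etaP.
have Flt q t x y : 0 <= t -> 0 <= x -> x < y ->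
    a x + t * band_inf eta x q < a y + t * band_inf eta y q.
  move=> t0 x0 xy; apply: ltr_leD; first exact: class_K_lt.
  by rewrite ler_wpM2l // band_inf_homo // ltW.
have Fc q t : {within `[0, +oo[, continuous (fun p => a p + t * band_inf eta p q)}.
  apply: within_continuousD; first exact: class_Kc.
  apply: within_continuousM.
    by apply: continuous_subspaceT => ?; exact: cvg_cst.
  by apply: within_continuous_lipschitz => x y; exact: band_inf_lipschitzl.
have /choice[B BE] : forall w : R * R, exists p, 0 <= w.1 -> 0 <= w.2 ->
    0 <= p /\ a p + w.2 * band_inf eta p (Q w.1) = a w.1.
  move=> [r t] /=.
  have [r0|r0] := leP 0 r; last by exists 0 => ?; lra.
  have [t0|t0] := leP 0 t; last by exists 0 => ? ?; lra.
  have [||p [/andP[p0 _] pE]] := ge0_root (c := a r) r0 (Fc (Q r) t).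
  - rewrite (class_K0 aK) band_inf0 ?mulr0 ?addr0 ?(class_K_ge0 aK) //.
    exact: class_K_ge0.
  - by rewrite lerDl mulr_ge0 ?band_inf_ge0.
  by exists p.
pose b r t := B (r, t).
have b0 r t : 0 <= r -> 0 <= t -> 0 <= b r t by move=> r0 t0; case: (BE (r, t)).
have bE r t : 0 <= r -> 0 <= t -> a (b r t) + t * band_inf eta (b r t) (Q r) = a r.
  by move=> r0 t0; case: (BE (r, t)).
(* By strict monotonicity in [p], the root is the largest solution of the inequality. *)
have b_max r t p : 0 <= r -> 0 <= t -> 0 <= p ->
    a p + t * band_inf eta p (Q r) <= a r -> p <= b r t.
  move=> r0 t0 p0 H; rewrite leNgt; apply/negP => bp.
  by have := Flt (Q r) t _ _ t0 (b0 r t r0 t0) bp; rewrite bE // ltNge H.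
have b_gt0 r t : 0 < r -> 0 <= t -> 0 < b r t.
  move=> r0 t0; rewrite lt0r b0 ?(ltW r0) // andbT; apply/eqP => br0.
  have := bE r t (ltW r0) t0.
  rewrite br0 (class_K0 aK) (band_inf0 etaP) ?mulr0 ?addr0; last exact/class_K_ge0/ltW.
  by case: aK => -[_ [_ /(_ r r0)]] + _ => /[swap] <-; rewrite ltxx.
have bc : {within [set p : R * R | 0 <= p.1 /\ 0 <= p.2],
    continuous (fun p => b p.1 p.2)}.
  apply: (@root_within_continuous R (R * R)%type _
    (fun p w => a p + w.2 * band_inf eta p (Q w.1) - a w.1)
    (fun w => b w.1 w.2)) => /=.
  - by move=> w [? ?]; exact: b0.
  - by move=> w [? ?]; rewrite bE // subrr.
  - by move=> w [w1 w2] x y x0 xy; rewrite ltrD2r; exact: Flt.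
  move=> x x0.
  have fst0 : {within [set p : R * R | 0 <= p.1 /\ 0 <= p.2], continuous fst}.
    by apply: continuous_subspaceT => ?; exact: cvg_fst.
  have snd0 : {within [set p : R * R | 0 <= p.1 /\ 0 <= p.2], continuous snd}.
    by apply: continuous_subspaceT => ?; exact: cvg_snd.
  have fst_ge0 (w : R * R) : [set p : R * R | 0 <= p.1 /\ 0 <= p.2] w ->
      `[0, +oo[%classic w.1 by case=> ? ?; rewrite /= in_itv /= andbT.
  apply: within_continuousB; last first.
    exact: (within_continuous_comp_sub fst_ge0 fst0 (class_Kc aK)).
  apply: within_continuousD.
    by apply: continuous_subspaceT => ?; exact: cvg_cst.
  apply: within_continuousM => //.
  have Qfst := within_continuous_comp_sub fst_ge0 fst0 (class_Kc QK).
  have band_cont : {within setT, continuous (band_inf eta x)}.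
    by apply: within_continuous_lipschitz => ? ?; exact: band_inf_lipschitzr.
  exact: (within_continuous_comp_sub _ Qfst band_cont).
exists b => //; split => //; split.
- move=> t t0; apply: class_KI.
  + have pc : {within `[0, +oo[, continuous (fun r : R => (r, t))}.
      by apply: continuous_subspaceT => r; exact: (cvg_pair cvg_id (cvg_cst _)).
    apply: (within_continuous_comp_sub _ pc bc).
    by move=> r /=; rewrite in_itv /= andbT.
  + apply/eqP; rewrite eq_le b0 // andbT.
    apply: (class_K_leI aK) => //.
    by rewrite -(bE 0 t) // lerDl mulr_ge0 ?band_inf_ge0.
  (* If the root did not grow with [r], both terms on the left would be no larger at [y] than at
     [x], as [band_inf] is nonincreasing in its upper endpoint; but [a x < a y]. *)
  + move=> x y x0 xy; rewrite ltNge; apply/negP => byx.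
    have y0 : 0 <= y by lra.
    have := class_K_lt aK x0 xy.
    rewrite -(bE y t) // -(bE x t) // ltNge => /negP; apply.
    rewrite lerD //; first by apply: class_K_le => //; exact: b0.
    by rewrite ler_wpM2l // band_inf_homo // (class_K_le QK) // ltW.
- move=> r r0; split; last split.
  + have pc : {within `[0, +oo[, continuous (fun t : R => (r, t))}.
      by apply: continuous_subspaceT => t; exact: (cvg_pair (cvg_cst _) cvg_id).
    apply: (within_continuous_comp_sub _ pc bc).
    by move=> t /=; rewrite in_itv /= andbT; split=> //; exact: ltW.
  (* The root is positive for [r > 0], and so is [band_inf] there; if the root did not drop, the
     later time would push the left side above [a r]. *)
  + have bd x y : 0 <= x -> x < y -> b r y < b r x.
      move=> x0 xy; rewrite ltNge; apply/negP => bxy.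
      have y0 : 0 <= y by lra.
      have := bE r y (ltW r0) y0; rewrite -(bE r x (ltW r0) x0).
      apply/eqP; rewrite gt_eqF //; apply: ler_ltD.
        by apply: class_K_le => //; exact/b0/x0/ltW.
      apply: (@le_lt_trans _ _ (x * band_inf eta (b r y) (Q r))).
        by rewrite ler_wpM2l // band_inf_homo.
      by rewrite ltr_pM2r // band_inf_gt0 // b_gt0.
    move=> x y; rewrite !in_itv /= !andbT => x0 y0.
    have [yx|xy|<-] := ltgtP y x; last by rewrite ltxx.
      by rewrite bd.
    by apply/negbTE; rewrite -leNgt ltW // bd.
  (* Once [t * band_inf eta e (Q r)] exceeds [a r], a root at or above [e] would violate the
     equation. *)
  + apply/cvgrPdist_lt => e e0.
    have g0 : 0 < band_inf eta e (Q r) by exact: band_inf_gt0.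
    have : \forall t \near +oo%R, a r / band_inf eta e (Q r) < t.
      by apply: nbhs_pinfty_gt; rewrite num_real.
    have : \forall t \near +oo%R, (0 : R) <= t by apply: nbhs_pinfty_ge; rewrite real0.
    apply: filterS2 => t t0; rewrite ltr_pdivrMr // => at_.
    have bt0 := b0 r t (ltW r0) t0.
    rewrite sub0r normrN ger0_norm // ltNge; apply/negP => ebt.
    have := bE r t (ltW r0) t0; apply/eqP; rewrite gt_eqF //.
    apply: (lt_le_trans at_).
    rewrite ler_wpDl //; first exact: (class_K_ge0 aK).
    by rewrite ler_wpM2l // band_inf_homo.
Qed.

End ClassKL.

(** * Dini derivatives and decay estimates *)

Section Dini.
Variable R : realType.

(** Encodes the bound [k] on the upper right Dini derivative, multiplied out by [h] so that neither
    quotients nor extended reals appear. *)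
Definition dini_ub (w : R -> R) (s k : R) :=
  forall e, 0 < e -> \forall h \near 0^'+, w (s + h) <= w s + (k + e) * h.

Lemma near_right0P (P : R -> Prop) :
  (\forall h \near 0^'+, P h) <->
  exists2 d, 0 < d & forall h, 0 < h < d -> P h.
Proof.
split=> [[d /= d0 dP]|[d d0 dP]].
  exists d => // h /andP[h0 hd]; apply: dP => //=.
  by rewrite sub0r normrN gtr0_norm.
exists d => //= h /=; rewrite sub0r normrN => hd h0; apply: dP.
by rewrite h0 -(gtr0_norm h0).
Qed.

(* The middle hypothesis is lower semicontinuity from the left. *)
Lemma dini_decay (w : R -> R) (a b k : R) : a <= b ->
  (forall s, a < s <= b -> forall e, 0 < e ->
     exists2 d, 0 < d & forall r, a <= r < s -> s - d < r -> w s <= w r + e) ->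
  (forall s, a <= s < b -> dini_ub w s k) ->
  w b <= w a + k * (b - a).
Proof.
move=> ab wl wd.
suff H e : 0 < e -> w b <= w a + (k + e) * (b - a).
  rewrite leNgt; apply/negP => gap.
  (* The divisor [b - a + 1] is positive even when [a = b], and it makes the error [e * (b - a)]
     strictly smaller than the gap [g]. *)
  have D0 : 0 < b - a + 1 by lra.
  set g := w b - (w a + k * (b - a)).
  have g0 : 0 < g / (b - a + 1) by rewrite divr_gt0 // subr_gt0.
  have := H _ g0; rewrite mulrDl addrA -lerBlDl -/g.
  rewrite mulrAC ler_pdivlMr // ler_pM2l ?subr_gt0 //; lra.
move=> e0; set K := k + e.
(* Let [c] be the supremum of the points where the bound with slope [K] holds. The bound holds at
   [c] too, and if [c < b] the Dini condition at [c] yields a larger such point. *)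
pose S := [set s | a <= s <= b /\ w s <= w a + K * (s - a)].
have Sa : S a by split; [rewrite lexx|rewrite subrr mulr0 addr0].
have supS : has_sup S.
  by split; [exists a|exists b => s [/andP[]]].
set c := sup S.
have ac : a <= c by exact: (ub_le_sup supS.2).
have cb : c <= b by apply: ge_sup supS.1 _ => s [/andP[]].
have Sc : S c.
  split; first by rewrite ac cb.
  rewrite leNgt; apply/negP => gap.
  set g := w c - (w a + K * (c - a)).
  have g0 : 0 < g by rewrite subr_gt0.
  have ac' : a < c.
    rewrite lt_neqAle ac andbT; apply/eqP => aE.
    by move: g0; rewrite /g -aE subrr mulr0 addr0 subrr ltxx.
  have [//|d d0 dP] := wl c _ (g / 3) ltac:(by rewrite divr_gt0).
    by rewrite ac' cb.
  have K1 : 0 < `|K| + 1 by have := normr_ge0 K; lra.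
  (* The semicontinuity error and the change of [K * s] between [r] and [c] each cost at most
     [g / 3], which cannot account for the whole gap [g]. *)
  set d' := Num.min d (g / 3 / (`|K| + 1)).
  have d'0 : 0 < d' by rewrite lt_min d0 !divr_gt0.
  have [r Sr cr] := sup_adherent d'0 supS.
  have [/andP[ar rb] wr] := Sr.
  have rc : r <= c by exact: (ub_le_sup supS.2).
  have rc' : r < c.
    rewrite lt_neqAle rc andbT; apply/eqP => rE.
    by move: gap; rewrite -rE ltNge wr.
  have dd : d' <= d by rewrite ge_min lexx.
  have := dP r; rewrite ar rc' => /(_ isT ltac:(rewrite -/c in cr; lra)) wcr.
  have : (c - r) * (`|K| + 1) <= g / 3.
    rewrite -ler_pdivlMr //; apply: le_trans (_ : d' <= _).
      by rewrite -/c in cr; lra.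
    by rewrite ge_min lexx orbT.
  have : - `|K| * (c - r) <= K * (c - r).
    by rewrite ler_wpM2r ?subr_ge0 // lerNnormlW.
  rewrite /g in wcr g0 *; nra.
have [cbE|cb'] := eqVneq c b; first by case: Sc; rewrite cbE.
have cb2 : c < b by rewrite lt_neqAle cb' cb.
have [|d d0 dP] := (near_right0P _).1 (wd c _ e e0); first by rewrite ac cb2.
set h := Num.min (d / 2) (b - c).
have h0 : 0 < h by rewrite lt_min divr_gt0 // subr_gt0.
have hd : h < d by rewrite gt_min; apply/orP; left; lra.
have hb : h <= b - c by rewrite ge_min lexx orbT.
have Sch : S (c + h).
  split; first by apply/andP; split; lra.
  have := dP h; rewrite h0 hd => /(_ isT); case: Sc => _; rewrite -/K.
  lra.
have := ub_le_sup supS.2 Sch; rewrite -/c; lra.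
Qed.

Lemma dini_ub_le (w : R -> R) s k k' : k <= k' -> dini_ub w s k -> dini_ub w s k'.
Proof.
move=> kk wk e e0; have := nbhs_right_gt (0 : R); have := wk e e0.
apply: filterS2 => h wh h0; apply: (le_trans wh).
by rewrite lerD2l ler_wpM2r ?(ltW h0) // lerD2r.
Qed.

(** A lower growth rate of [v] to the right of [s] is enough; in the iISS proof [v] is the integral
    of the input gain. *)
Lemma dini_ubB (w v : R -> R) s k l : dini_ub w s k ->
  (forall e, 0 < e -> \forall h \near 0^'+, (l - e) * h <= v (s + h) - v s) ->
  dini_ub (fun s => w s - v s) s (k - l).
Proof.
move=> wk vl e e0; have e20 : 0 < e / 2 by rewrite divr_gt0.
have := vl _ e20; have := wk _ e20.
apply: filterS2 => h wh vh; have -> : (k - l + e) = (k + e / 2) - (l - e / 2) by field.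
by rewrite mulrBl; lra.
Qed.

(** Where [w] is below [L] the maximum is constant on a short interval to the right, whatever the
    sign of [k]; elsewhere the rate is nonpositive. *)
Lemma dini_ub_max (w : R -> R) s k L : dini_ub w s k ->
  (L <= w s -> k <= 0) -> dini_ub (fun s => Num.max (w s) L) s 0.
Proof.
move=> wk kneg e e0; have hpos := nbhs_right_gt (0 : R).
case: (boolP (L <= w s)) => [Lw|]; last rewrite -ltNge => wL.
  have := wk e e0; move: hpos; apply: filterS2 => h h0 wh.
  rewrite (max_l Lw) add0r ge_max; apply/andP; split.
    apply: (le_trans wh); rewrite lerD2l ler_wpM2r ?(ltW h0) //.
    by have := kneg Lw; lra.
  by rewrite (le_trans Lw) // lerDl mulr_ge0 // ltW.
(* The Dini bound is used with error 1, hence slope [k + 1]; for [h] below the quotient in [d0], [w]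
   cannot climb from [w s] to [L]. *)
have k10 : 0 < `|k + 1| + 1 by have := normr_ge0 (k + 1); lra.
have d0 : 0 < (L - w s) / (`|k + 1| + 1) by rewrite divr_gt0 // subr_gt0.
have := nbhs_right_lt d0; have := wk 1 ltr01; move: hpos.
apply: filterS3 => h h0 wh.
rewrite ltr_pdivlMr // => hL.
have : (k + 1) * h <= `|k + 1| * h by rewrite ler_wpM2r ?ler_norm // ltW.
have : 0 <= e * h by rewrite mulr_ge0 // ltW.
rewrite (max_r (ltW wL)) add0r ge_max => ? ?; apply/andP; split; nra.
Qed.

Lemma limf_esup_dini_ub (w q : R -> R) s k :
  (forall h, w (s + h) = w s + q h * h) ->
  (limf_esup (fun h => (q h)%:E) (0^'+) <= k%:E)%E ->
  dini_ub w s k.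
Proof.
move=> wq lek e e0.
have : (limf_esup (fun h => (q h)%:E) 0^'+ < (k + e)%:E)%E.
  by apply: le_lt_trans lek _; rewrite lte_fin; lra.
rewrite /limf_esup => /ereal_inf_lt[_ [A FA <-] supA].
have := nbhs_right_gt (0 : R); move: FA; apply: filterS2 => h Ah h0.
rewrite wq lerD2l ler_wpM2r ?(ltW h0) // -lee_fin.
by apply: le_trans (ltW supA); apply: ereal_sup_ubound; exists h.
Qed.

End Dini.

(** * Lower growth of integrals *)

Section IntegralGrowth.
Variable R : realType.
Implicit Types f : R -> R.
Local Notation mu := (@lebesgue_measure R).

(** The difference of the integrals is the integral over the half-open interval from [r] to [s],
    which is why [r] itself is excluded from the bound on [f]. *)
Lemma Rintegral_growth f (a r s c : R) :
  mu.-integrable `[a, s] (EFin \o f) -> a <= r <= s ->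
  (forall x, r < x <= s -> c <= f x) ->
  c * (s - r) <= Rintegral mu `[a, s] f - Rintegral mu `[a, r] f.
Proof.
move=> fi /andP[ar rs] cf.
rewrite Rintegral_itvB ?bnd_simp //.
have fi' : mu.-integrable `]r, s] (EFin \o f).
  apply: integrableS fi => //.
  by move=> x /=; rewrite !in_itv /= => /andP[/ltW rx ->]; rewrite (le_trans ar).
have -> : c * (s - r) = Rintegral mu `]r, s] (fun=> c).
  rewrite Rintegral_cst //; congr (_ * _).
  rewrite /= lebesgue_measure_itv /= lte_fin.
  by move: rs; rewrite le_eqVlt => /orP[/eqP->|->//]; rewrite ltxx subrr.
apply: le_Rintegral => //.
  apply: (@measurable_bounded_integrable _ _ _ mu (fun=> c)) => //.
    by rewrite /= lebesgue_measure_itv /=; case: ifP => // _; rewrite ltry.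
  exact: bounded_cst.
Qed.

End IntegralGrowth.

(** * Piecewise continuous inputs *)

Section Inputs.
Variables (R : realType) (U : normedModType R).
Local Notation mu := (@lebesgue_measure R).

Lemma PC_ler_norm (u : R -> U) s : PC u -> 0 <= s -> `|u s| <= normPC u.
Proof.
move=> [[M uM] _] s0; apply: ub_le_sup.
  by exists M => x [r /=]; rewrite in_itv /= andbT => r0 <-; exact: uM.
by exists s => //=; rewrite in_itv /= andbT.
Qed.

Lemma normPC_ge0 (u : R -> U) : PC u -> 0 <= normPC u.
Proof. by move=> uPC; apply: le_trans (PC_ler_norm uPC (lexx 0)). Qed.

(** Off a finite set the integrand is continuous on an open set, and finite sets are harmless for
    measurability; boundedness of [u] then gives integrability on a bounded interval. *)
Lemma PC_integrable (chi : R -> R) (u : R -> U) (a b : R) :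
  class_K chi -> PC u -> 0 <= a ->
  mu.-integrable `[a, b] (EFin \o (fun s => chi `|u s|)).
Proof.
move=> chiK uPC a0.
have mb : measurable_fun `[a, b] (fun s => chi `|u s|).
  have [_ [_ [_ /(_ b) Sfin]]] := uPC.
  set S := [set s | _] in Sfin.
  have Sclosed : closed S.
    by apply/accessible_finite_set_closed: S Sfin; exact/hausdorff_accessible/Rhausdorff.
  have finm (F : set R) : finite_set F -> measurable_fun F (fun s => chi `|u s|).
    move=> Ff mF Y mY; apply: countable_measurable => //.
    by apply: finite_set_countable; exact: finite_setIl.
  have finM (F : set R) : finite_set F -> measurable F.
    by move=> Ff; apply: countable_measurable => //; exact: finite_set_countable.
  pose A := `]0, b[%classic `&` ~` S.
  have oA : open A by apply: openI => //; exact: closed_openC.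
  have mA : measurable A by exact: measurable_realfun.open_measurable.
  (* The points 0 and [b] join the finite exceptional set, because [A] has to be open and inputs are
     controlled only on the nonnegative axis. *)
  have AE : `[a, b] `<=` A `|` (S `|` [set 0; b]).
    move=> x /=; rewrite in_itv /= => /andP[ax xb].
    have [->|x0] := eqVneq x 0; first by right; right; left.
    have [->|xb'] := eqVneq x b; first by right; right; right.
    have [Sx|nSx] := pselect (S x); first by right; left.
    left; split=> //=; rewrite in_itv /= !lt_neqAle eq_sym x0 xb' xb /= andbT.
    exact: le_trans ax.
  have fin2 : finite_set (S `|` [set 0; b]).
    by rewrite finite_setU; split=> //; exact: finite_set2.
  apply: measurable_funS AE _; first by apply: measurableU => //; exact: finM.
  apply/measurable_funU => //; first exact: finM.
  split; last exact: finm.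
  apply: measurable_realfun.open_continuous_measurable_fun => // s; rewrite inE => -[].
  rewrite /= in_itv /= => /andP[s0 sb] nSs.
  have us : u x @[x --> s] --> u s.
    by apply: contrapT => nus; apply: nSs; split=> //; rewrite s0 ltW.
  have /within_continuous_distP chic := class_Kc chiK.
  apply/cvgrPdist_lt => e e0.
  have := chic `|u s|; rewrite /= in_itv /= normr_ge0 => /(_ isT e e0) chin.
  have : \forall x \near `|u s|, 0 <= x -> `|chi `|u s| - chi x| < e.
    by apply: filterS chin => x H x0; apply: H; rewrite /= in_itv /= x0.
  move=> /(cvg_norm us)[d /= d0 dP]; exists d => //= x xd.
  exact: (dP x xd (normr_ge0 _)).
apply: (@measurable_bounded_integrable _ _ _ mu (fun s => chi `|u s|)) => //.
  by rewrite /= lebesgue_measure_itv /=; case: ifP => // _; rewrite ltry.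
exists (chi (normPC u)); split; first exact: num_real.
move=> M chiM s /=; rewrite in_itv /= => /andP[as_ _].
have s0 := le_trans a0 as_.
rewrite ger0_norm ?(class_K_ge0 chiK) //.
by apply/ltW/le_lt_trans/chiM/(class_K_le chiK) => //; exact: PC_ler_norm.
Qed.

(** Follows from right continuity of [u]; [Rintegral_growth] turns it into a lower growth rate of
    the integral at [s], as required by [dini_ubB]. *)
Lemma PC_right_lower (chi : R -> R) (u : R -> U) s e :
  class_K chi -> PC u -> 0 <= s -> 0 < e ->
  \forall h \near 0^'+, forall x, s < x <= s + h -> chi `|u s| - e <= chi `|u x|.
Proof.
move=> chiK [_ [ur _]] s0 e0.
have /within_continuous_distP chic := class_Kc chiK.
have := chic `|u s|; rewrite /= in_itv /= normr_ge0 => /(_ isT e e0) chin.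
have /(cvg_norm (ur s s0)) [d /= d0 dP] :
    \forall x \near `|u s|, 0 <= x -> `|chi `|u s| - chi x| < e.
  by apply: filterS chin => x H x0; apply: H; rewrite /= in_itv /= x0.
apply/near_right0P; exists d => // h /andP[h0 hd] x /andP[sx xh].
have := dP x; rewrite /= ltr0_norm ?subr_lt0 // opprB.
move=> /(_ ltac:(lra) sx (normr_ge0 _)).
by rewrite ltr_norml => /andP[_]; lra.
Qed.

End Inputs.

(** * Gain extracted from the dissipation inequality *)

Section Gain.
Variable R : realType.

(** In the second alternative strictness comes from [chi N < chi (N + 1) < chi (N + 2)], the last
    value being at most the limit of [chi]. *)
Lemma dissipation_gap (eta chi : R -> R) : class_K chi ->
  ((eta x)%:E @[x --> +oo%R] --> +oo%E \/
   (lim ((chi x)%:E @[x --> +oo%R])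
      <= limf_einf (fun x : R => (eta x)%:E) (+oo%R : set_system R))%E) ->
  forall N, 0 <= N ->
    exists c a, [/\ chi N < c, 0 <= a & forall r, a <= r -> c <= eta r].
Proof.
move=> chiK Heta N N0.
suff [c Nc [a [_ aP]]] : exists2 c, chi N < c & \forall x \near +oo%R, c <= eta x.
  exists c, (Num.max (a + 1) 0); split=> //; first by rewrite le_max lexx orbT.
  by move=> r ar; apply: aP; move: ar; rewrite ge_max => /andP[? _]; lra.
case: Heta => [eta_oo|chi_eta].
  exists (chi N + 1); first by lra.
  have [a [ar aP]] := cvgey_ge eta_oo (chi N + 1).
  by exists a; split=> // x /aP /=; rewrite lee_fin.
exists (chi (N + 1)); first by apply: class_K_lt => //; lra.
(* [chi] is monotone only on the nonnegative axis; freezing it at [chi 0] for negative arguments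
   gives a globally monotone function, whose limit is its supremum. *)
pose chi0 x := (chi (Num.max x 0))%:E.
have chi0_homo : {homo chi0 : x y / x <= y >-> (x <= y)%E}.
  move=> p q pq; rewrite lee_fin; apply: class_K_le => //.
    by rewrite le_max lexx orbT.
  by rewrite le_max2.
have chi_cvg : (chi x)%:E @[x --> +oo%R] --> ereal_sup (range chi0).
  have chi0E : {near +oo%R, chi0 =1 (fun x => (chi x)%:E)}.
    exists 0; split; first exact: real0.
    by move=> x x0; rewrite /chi0 max_l // ltW.
  exact: cvg_trans (near_eq_cvg chi0E) (nondecreasing_cvge chi0_homo).
rewrite (cvg_lim _ chi_cvg) // in chi_eta.
have : ((chi (N + 1))%:E < limf_einf (fun x : R => (eta x)%:E) (+oo%R : set_system R))%E.
  apply: lt_le_trans chi_eta; apply: (@lt_le_trans _ _ (chi0 (N + 2))).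
    by rewrite lte_fin max_l; [apply: class_K_lt => //|]; lra.
  by apply: ereal_sup_ubound; exists (N + 2).
rewrite limf_einfE => /ereal_sup_gt[_ [A FA <-] Ainf].
apply: filterS FA => x Ax; rewrite -lee_fin; apply: le_trans (ltW Ainf) _.
by apply: ereal_inf_lbound; exists x.
Qed.

(* [rho] solves [tail_inf eta r * r / (1 + r) = chi N]; the remaining fraction
   [tail_inf eta r / (1 + r)] of the dissipation does not depend on N. *)
Lemma dissipation_gain (eta chi : R -> R) : class_P eta -> class_K chi ->
  (forall N, 0 <= N ->
    exists c a, [/\ chi N < c, 0 <= a & forall r, a <= r -> c <= eta r]) ->
  exists rho eta', [/\ class_K rho, class_P eta' &
    forall N r, 0 <= N -> rho N <= r -> chi N + eta' r <= eta r].
Proof.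
move=> etaP chiK gap.
pose th (r : R) := (1 + r)^-1.
have thc : {within `[0, +oo[, continuous th}.
  apply/subspace_continuousP => r /=; rewrite in_itv /= andbT => r0.
  apply: cvgV; first by rewrite gt_eqF //; lra.
  by apply: cvgD; [exact: cvg_cst|exact: cvg_within].
have th_gt0 r : 0 <= r -> 0 < th r by move=> r0; rewrite invr_gt0; lra.
have th_lt r s : 0 <= r -> r < s -> th s < th r.
  by move=> r0 rs; rewrite ltf_pV2 ?posrE; lra.
have th_le1 r : 0 <= r -> th r <= 1.
  by move=> r0; rewrite invf_le1; lra.
have tc : {within `[0, +oo[, continuous (tail_inf eta)}.
  by apply: within_continuous_lipschitz => ? ?; exact: tail_inf_lipschitz.
have tail_gt0 r : 0 < r -> 0 < tail_inf eta r.
  have [c [a []]] := gap 0 (lexx 0); rewrite (class_K0 chiK) => c0 _ ca.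
  exact: (tail_inf_gt0 etaP c0 ca).
pose f r := tail_inf eta r * (1 - th r).
have fK : class_K f.
  apply: class_KI.
  - apply: within_continuousM => //; apply: within_continuousB => //.
    by apply: continuous_subspaceT => ?; exact: cvg_cst.
  - by rewrite /f tail_inf0 // mul0r.
  - move=> r s r0 rs; apply: (@le_lt_trans _ _ (tail_inf eta s * (1 - th r))).
      rewrite ler_wpM2r ?subr_ge0 ?th_le1 //.
      by apply: tail_inf_homo => //; exact: ltW.
    by rewrite ltr_pM2l ?ltrD2l ?ltrN2 ?th_lt // tail_gt0 //; lra.
have [N N0|rho rhoK rhoE] := class_K_root fK chiK.
  have [c [a [Nc a0 ca]]] := gap N N0.
  have cN : 0 < c - chi N by rewrite subr_gt0.
  have chiN0 : 0 <= chi N by exact: class_K_ge0.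
  (* [r1] is the point where [c * r / (1 + r)] equals [chi N]; adding [a + c] also brings
     [tail_inf eta r] up to [c], by [tail_inf_ge]. *)
  set r1 := chi N / (c - chi N).
  have r10 : 0 <= r1 by rewrite divr_ge0 // ltW.
  have r1E : r1 * (c - chi N) = chi N by rewrite divfK // gt_eqF.
  pose r := a + c + r1.
  have r0 : 0 <= r by rewrite /r; lra.
  exists r => //; apply: (@le_trans _ _ (c * (1 - th r))); last first.
    rewrite ler_wpM2r ?subr_ge0 ?th_le1 //.
    by apply: (tail_inf_ge etaP a0 ca); rewrite /r; lra.
  have r1' : 0 < 1 + r by lra.
  rewrite -(ler_pM2r r1') -mulrA mulrBl mul1r mulVf ?gt_eqF //.
  have : r1 * (c - chi N) <= r * (c - chi N).
    by rewrite ler_wpM2r ?ltW // /r; lra.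
  lra.
exists rho, (fun r => tail_inf eta r * th r); split=> //.
- split; first exact: within_continuousM.
  split; first by rewrite tail_inf0 // mul0r.
  by move=> r r0; rewrite mulr_gt0 ?tail_gt0 ?th_gt0 // ltW.
- move=> N r N0 rhor; have [rho0 rhoN] := rhoE N N0.
  have r0 : 0 <= r := le_trans rho0 rhor.
  (* [tail_inf eta r] splits into [f r] and the retained fraction, and [f r] is at least
     [f (rho N) = chi N]. *)
  apply: le_trans (tail_inf_le etaP r0 (lexx r)).
  have := class_K_le fK rho0 rhor; rewrite rhoN /f mulrBr mulr1; lra.
Qed.

End Gain.

(** * Estimates along trajectories *)

Section Trajectories.
Variables (R : realType) (U X : normedModType R).
Variables (phi : R -> R -> X -> (R -> U) -> X) (tm : R -> X -> (R -> U) -> \bar R).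
Variables (V : R -> X -> R) (a1 a2 eta chi : R -> R).
Hypothesis CS : control_system phi tm.
Hypothesis LF : coercive_iISS_LF phi V a1 a2 eta chi.

Let a1K : class_K a1. Proof. by case: LF => _ [_] [_] [[]]. Qed.
Let a2K : class_K a2. Proof. by case: LF => _ [_] [_] [_] [[]]. Qed.
Let etaP : class_P eta. Proof. by case: LF => _ [_] [_] [_] [_] []. Qed.
Let chiK : class_K chi. Proof. by case: LF => _ [_] [_] [_] [_] [_] []. Qed.

Let V_bounds t x : 0 <= t -> a1 `|x| <= V t x <= a2 `|x|.
Proof. by case: LF => _ [_] [_] [_] [_] [_] [_] [H _]; exact: H. Qed.

Section Trajectory.
Variables (t0 : R) (x0 : X) (u : R -> U).
Hypotheses (t0_ge0 : 0 <= t0) (uPC : PC u).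

Let x s := phi s t0 x0 u.
Let y s := V s (x s).

Lemma LF_left_continuous s : t0 < s -> (s%:E < tm t0 x0 u)%E ->
  forall e, 0 < e ->
  exists2 d, 0 < d & forall r, t0 <= r < s -> s - d < r -> `|y s - y r| < e.
Proof.
move=> ts stm e e0; have [_ [_ [_ [xc _]]]] := CS x0 t0_ge0 uPC.
have [Vc _] := LF.
set D := [set t | _] in xc.
have pc : {within D, continuous (fun t => (t, x t))}.
  apply/subspace_continuousP => t Dt.
  move/subspace_continuousP: xc => /(_ t Dt) xt.
  have idc : r @[r --> within D (nbhs t)] --> t by exact: cvg_within.
  exact: (cvg_pair idc xt).
have Dpos t : D t -> [set p : R * X | 0 <= p.1] (t, x t).
  by move=> [tt _] /=; exact: le_trans tt.
have /within_continuous_distP := within_continuous_comp_sub Dpos pc Vc.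
have Ds : D s by split=> //; exact: ltW.
move=> /(_ s Ds e e0) [d /= d0 dP]; exists d => // r /andP[tr rs] sr.
apply: dP => /=; first by rewrite gtr0_norm ?subr_gt0 //; lra.
by split=> //; apply: lt_trans stm; rewrite lte_fin.
Qed.

(** The Lie derivative concerns the trajectory restarted from [x s] at time [s]; the cocycle
    property identifies it with the original one as long as [s + h] stays below the existence
    time. *)
Lemma LF_dini s : t0 <= s -> (s%:E < tm t0 x0 u)%E ->
  dini_ub y s (- eta `|x s| + chi `|u s|).
Proof.
move=> ts stm; have s0 : 0 <= s := le_trans t0_ge0 ts.
have [_ [_ [_ [_ cocycle]]]] := CS x0 t0_ge0 uPC.
have [_ [xs0 _]] := CS (x s) s0 uPC.
pose w r := V r (phi r s (x s) u).
have wk : dini_ub w s (- eta `|x s| + chi `|u s|).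
  apply: (@limf_esup_dini_ub _ _ (fun h => (w (s + h) - V s (x s)) / h)).
    (* At [h = 0] the quotient is multiplied by 0, and both sides are [V s (x s)] by the identity
       property of [phi]. *)
    move=> h; rewrite /w xs0; have [->|h0] := eqVneq h 0.
      by rewrite mulr0 !addr0 xs0.
    by rewrite divfK // [RHS]addrC subrK.
  case: LF => _ [_] [_] [_] [_] [_] [_] [_]; exact.
have near_tm : \forall h \near 0^'+, ((s + h)%:E < tm t0 x0 u)%E.
  apply/near_right0P; move: stm; case: (tm t0 x0 u) => [r||].
  - rewrite lte_fin => sr; exists (r - s); rewrite ?subr_gt0 // => h /andP[_ hr].
    by rewrite lte_fin; lra.
  - by move=> _; exists 1 => // h _; rewrite ltry.
  - by rewrite ltNge leNye.
move=> e e0; have := nbhs_right_gt (0 : R); have := wk e e0; move: near_tm.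
apply: filterS3 => h shtm wh h0; move: wh.
rewrite /w xs0 -/(y s) (cocycle s (s + h) _ shtm).2 //.
by rewrite ts lerDl ltW.
Qed.

Lemma LF_growth t : t0 <= t -> (t%:E < tm t0 x0 u)%E ->
  y t <= y t0 + chi (normPC u) * (t - t0).
Proof.
move=> tt ttm; apply: dini_decay => //.
- move=> s /andP[ts st] e e0.
  have stm : (s%:E < tm t0 x0 u)%E by apply: le_lt_trans ttm; rewrite lee_fin.
  have [d d0 dP] := LF_left_continuous ts stm e0; exists d => // r rs sr.
  by have := dP r rs sr; rewrite ltr_norml => /andP[_]; lra.
- move=> s /andP[ts st].
  have stm : (s%:E < tm t0 x0 u)%E by apply: lt_trans ttm; rewrite lte_fin.
  have s0 := le_trans t0_ge0 ts.
  apply: dini_ub_le (LF_dini ts stm).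
  have := class_P_ge0 etaP (normr_ge0 (x s)).
  have : chi `|u s| <= chi (normPC u).
    by apply: class_K_le => //; exact: PC_ler_norm.
  lra.
Qed.

End Trajectory.

(** If the existence time were finite, [LF_growth] would bound [V] along the trajectory, and
    unboundedness of [a1] would then bound the state, against BIC. *)
Lemma LF_forward_complete : BIC phi tm -> forward_complete phi tm.
Proof.
move=> bic t0 x0 u t00 uPC; apply/eqP/negP => tmN.
have tmlt : (tm t0 x0 u < +oo)%E by rewrite ltey; exact/negP.
have [t0tm [xt0 _]] := CS x0 t00 uPC.
apply: (bic t0 x0 u t00 uPC tmlt).
case E : (tm t0 x0 u) => [b||]; last 2 first.
- by rewrite E ltxx in tmlt.
- by rewrite E ltNge leNye in t0tm.
have [_ [_ [_ [[_ a1inf] _]]]] := LF.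
have [M [M0 MP]] := a1inf (V t0 x0 + chi (normPC u) * (b - t0)).
exists M => t t0t; rewrite lte_fin => tb.
apply: (class_K_leI a1K) => //; apply: le_trans (ltW MP).
have /andP[a1x _] := V_bounds (phi t t0 x0 u) (le_trans t00 t0t).
apply: (le_trans a1x); apply: le_trans (LF_growth t00 uPC t0t _) _.
  by rewrite E lte_fin.
rewrite xt0 lerD2l ler_wpM2l //; last by lra.
by apply: class_K_ge0 => //; exact: normPC_ge0.
Qed.

Hypothesis FC : forward_complete phi tm.

Let stm t0 x0 u s : 0 <= t0 -> PC u -> (s%:E < tm t0 x0 u)%E.
Proof. by move=> t00 uPC; rewrite FC // ltry. Qed.

(* With y = V along the trajectory, I the integral of the input gain and
   z = y - I, z is nonincreasing. If z(t) <= 0 or y(t0) <= I(t) then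
   y(t) <= 2 I(t). Otherwise y stays in [z(t), 2 y(t0)], so that z decreases at
   the rate [band_inf eta] of the corresponding band of state norms. *)
Lemma LF_iISS : iISS phi tm.
Proof.
split=> //.
have [_ [_ [_ [a1Kinf [a2Kinf _]]]]] := LF.
have [g1 [g1K g1inf] g1E] := class_Kinf_inv a1Kinf.
have [g2 [g2K _] g2E] := class_Kinf_inv a2Kinf.
have g1scaleK k : 0 < k -> class_K (fun r => g1 (k * r)).
  by move=> k0; exact: class_K_comp g1K (class_K_scale k0).
(* [g1 (2 * a2 r)] bounds the state norm as long as [V] is at most [2 * a2 r]. *)
have g12K : class_K (fun r => g1 (2 * a2 r)).
  by apply: (class_K_comp (g1scaleK 2 _) a2K).
have [B BKL Bmax] := class_KL_decay a2K g12K etaP.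
(* With [A] for [a2] of the [B] term, the final bound on [V] is [A + 2 * I t], which is at most
   [2 * A] or [4 * I t] according to the dominant summand. *)
exists (fun s => g1 (4 * s)), chi, (fun r t => g1 (2 * a2 (B r t))).
split.
  split; [exact: g1scaleK|move=> M]; have [r [r0 Mr]] := g1inf M; exists (r / 4).
  by rewrite divr_ge0 // mulrC divfK.
split=> //; split; first exact: class_KL_comp g12K BKL.
move=> t0 x0 u t t00 uPC t0t.
have [_ [xt0 _]] := CS x0 t00 uPC.
set x := fun s => phi s t0 x0 u; rewrite -/(x t).
pose y s := V s (x s).
pose I s := Rintegral lebesgue_measure `[t0, s] (fun s => chi `|u s|).
rewrite -/(I t).
have I0 s : 0 <= I s.
  by apply: Rintegral_ge0 => r _; apply: class_K_ge0.
have Igrow r s c : t0 <= r <= s -> (forall q, r < q <= s -> c <= chi `|u q|) ->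
    c * (s - r) <= I s - I r.
  by move=> rs cq; apply: Rintegral_growth => //; exact: PC_integrable.
have Imono r s : t0 <= r <= s -> I r <= I s.
  move=> rs; rewrite -subr_ge0 -[leLHS](mul0r (s - r)); apply: Igrow => // q _.
  exact: class_K_ge0.
pose z s := y s - I s.
have z_dini s : t0 <= s -> dini_ub z s (- eta `|x s|).
  move=> ts; have s0 := le_trans t00 ts.
  have -> : - eta `|x s| = - eta `|x s| + chi `|u s| - chi `|u s| by lra.
  apply: dini_ubB; first exact: (LF_dini t00 uPC ts (stm x0 s t00 uPC)).
  move=> e e0; have := nbhs_right_gt (0 : R).
  have := PC_right_lower chiK uPC s0 e0; apply: filterS2 => h uh h0.
  have := Igrow s (s + h) (chi `|u s| - e); rewrite addrAC subrr add0r; apply=> //.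
  by rewrite ts lerDl ltW.
(* [I] is nondecreasing, so subtracting it preserves lower semicontinuity from the left. *)
have z_left s : t0 < s -> forall e, 0 < e ->
    exists2 d, 0 < d & forall r, t0 <= r < s -> s - d < r -> z s <= z r + e.
  move=> ts e e0.
  have [d d0 dP] := LF_left_continuous t00 uPC ts (stm x0 s t00 uPC) e0.
  exists d => // r /andP[tr rs] sr.
  have := dP r; rewrite tr rs => /(_ isT sr); rewrite ltr_norml => /andP[_].
  have := Imono r s; rewrite tr (ltW rs) => /(_ isT); rewrite /z /y; lra.
have z_decay r s c : t0 <= r <= s -> (forall q, r <= q < s -> c <= eta `|x q|) ->
    z s <= z r - c * (s - r).
  move=> /andP[tr rs] cq; rewrite -mulNr; apply: dini_decay => //.
  - move=> q /andP[rq qs] e e0; have [d d0 dP] := z_left q (le_lt_trans tr rq) e e0.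
    by exists d => // v /andP[rv vq] qv; apply: dP => //; rewrite (le_trans tr).
  - move=> q /andP[rq qs]; apply: dini_ub_le (z_dini q (le_trans tr rq)).
    by rewrite lerN2 cq // rq.
have z_mono r s : t0 <= r <= s -> z s <= z r.
  move=> rs; have := z_decay r s 0 rs; rewrite mul0r subr0; apply=> q _.
  exact: class_P_ge0.
have y0 s : t0 <= s -> 0 <= y s.
  by move=> ts; case: LF => _ [+ _]; apply; exact: le_trans ts.
have r0 : 0 <= `|x0| by [].
have T0 : 0 <= t - t0 by rewrite subr_ge0.
have yt0 : y t0 <= a2 `|x0|.
  by have /andP[_] := V_bounds (x t0) t00; rewrite /y /x xt0.
have b0 : 0 <= B `|x0| (t - t0).
  by case: BKL => _ [BK _]; apply: (class_K_ge0 (BK _ T0)).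
have yz s : y s = z s + I s by rewrite /z subrK.
have zt0 : z t0 <= y t0 by rewrite /z gerBl.
suff yt : y t <= a2 (B `|x0| (t - t0)) + 2 * I t.
  have /andP[a1x _] := V_bounds (x t) (le_trans t00 t0t).
  have A0 : 0 <= a2 (B `|x0| (t - t0)) := class_K_ge0 a2K b0.
  have It0 := I0 t.
  have le_g1 c : 0 <= c -> y t <= c -> `|x t| <= g1 c.
    move=> c0 yc; have [g10 g1c] := g1E c c0.
    by apply: (class_K_leI a1K g10); rewrite g1c; exact: le_trans yc.
  have g0 c : 0 <= c -> 0 <= g1 c by move=> /g1E[].
  have [AI|IA] := leP (2 * I t) (a2 (B `|x0| (t - t0))).
    apply: (@le_trans _ _ (g1 (2 * a2 (B `|x0| (t - t0))))).
      by apply: le_g1; lra.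
    by rewrite lerDl g0 //; lra.
  apply: (@le_trans _ _ (g1 (4 * I t))).
    by apply: le_g1; lra.
  by rewrite lerDr g0 //; lra.
have A0 : 0 <= a2 (B `|x0| (t - t0)) := class_K_ge0 a2K b0.
have It0 := I0 t.
have [zt|zt] := leP (z t) 0; first by rewrite yz; lra.
have [yI|Iy] := leP (y t0) (I t).
  have := z_mono t0 t; rewrite lexx t0t => /(_ isT); rewrite yz; lra.
(* [p] is the lower end of the band: [a2 p = z t], while [a2] of the state norm at an earlier [s] is
   at least [y s], hence at least [z s] and [z t]. *)
have [p0 pE] := g2E _ (ltW zt); set p := g2 (z t) in p0 pE.
suff pB : p <= B `|x0| (t - t0).
  by have := class_K_le a2K p0 pB; rewrite yz; lra.
apply: Bmax => //; rewrite pE.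
have := z_decay t0 t (band_inf eta p (g1 (2 * a2 `|x0|))).
rewrite lexx t0t => /(_ isT) decay.
suff : z t <= z t0 - band_inf eta p (g1 (2 * a2 `|x0|)) * (t - t0).
  by rewrite (mulrC (t - t0)); lra.
apply: decay => s /andP[ts st]; apply: band_inf_le => //.
have /andP[a1x a2x] := V_bounds (x s) (le_trans t00 ts).
apply/andP; split.
  apply: (class_K_leI a2K) => //; rewrite pE; apply: le_trans a2x.
  rewrite -/(y s); apply: (@le_trans _ _ (z s)); first by apply: z_mono; rewrite ts ltW.
  by rewrite /z gerBl.
(* Upper end of the band: [y s = z s + I s] is at most [y t0 + I t], and [I t < y t0] in the
   remaining case. *)
have A20 : 0 <= 2 * a2 `|x0| by rewrite mulr_ge0 // class_K_ge0.
have [g10 g1c] := g1E _ A20.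
apply: (class_K_leI a1K g10); rewrite g1c; apply: (le_trans a1x); rewrite -/(y s) yz.
have := z_mono t0 s; rewrite lexx ts => /(_ isT).
have := Imono s t; rewrite ts (ltW st) => /(_ isT); lra.
Qed.

(** If [y t] is at most [a2 (rho N)], the gain term alone suffices. Otherwise [y] exceeds that level
    on the whole interval from [t0] to [t], so it decreases at a rate given by [eta'] on the band of
    norms from [g2 (y t)] to [g1] of [a2] at the initial norm, and [class_KL_decay] applies. *)
Lemma LF_ISS (rho eta' : R -> R) : class_K rho -> class_P eta' ->
  (forall N r, 0 <= N -> rho N <= r -> chi N + eta' r <= eta r) -> ISS phi tm.
Proof.
move=> rhoK eta'P gain; split=> //.
have [_ [_ [_ [a1Kinf [a2Kinf _]]]]] := LF.
have [g1 [g1K _] g1E] := class_Kinf_inv a1Kinf.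
have [g2 [g2K _] g2E] := class_Kinf_inv a2Kinf.
have QK := class_K_comp g1K a2K.
have [B BKL Bmax] := class_KL_decay a2K QK eta'P.
exists (fun r t => g1 (a2 (B r t))), (fun N => g1 (a2 (rho N))).
split; first exact: class_KL_comp QK BKL.
split; first exact: (class_K_comp QK rhoK).
move=> t0 x0 u t t00 uPC t0t.
have [_ [xt0 _]] := CS x0 t00 uPC.
set x := fun s => phi s t0 x0 u; rewrite -/(x t).
pose y s := V s (x s).
have T0 : 0 <= t - t0 by rewrite subr_ge0.
have b0 : 0 <= B `|x0| (t - t0).
  by case: BKL => _ [BK _]; apply: (class_K_ge0 (BK _ T0)).
have N0 := normPC_ge0 uPC; set N := normPC u in N0 *.
have rho0 : 0 <= rho N := class_K_ge0 rhoK N0.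
have le_g1 c : 0 <= c -> y t <= a2 c -> `|x t| <= g1 (a2 c).
  move=> c0 yc; have [g10 g1c] := g1E (a2 c) (class_K_ge0 a2K c0).
  apply: (class_K_leI a1K g10); rewrite g1c; apply: le_trans yc.
  by have /andP[] := V_bounds (x t) (le_trans t00 t0t).
have g0 c : 0 <= c -> 0 <= g1 (a2 c) by move=> c0; apply: (class_K_ge0 QK).
have [yL|Ly] := leP (y t) (a2 (rho N)).
  by apply: (le_trans (le_g1 _ rho0 yL)); rewrite lerDr g0.
set L := a2 (rho N) in Ly.
have L0 : 0 <= L by exact: class_K_ge0.
suff yB : y t <= a2 (B `|x0| (t - t0)).
  by apply: (le_trans (le_g1 _ b0 yB)); rewrite lerDl g0.
have y_dini s : t0 <= s -> dini_ub y s (- eta `|x s| + chi `|u s|).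
  by move=> ts; exact: (LF_dini t00 uPC ts (stm x0 s t00 uPC)).
have y_left s : t0 < s -> forall e, 0 < e ->
    exists2 d, 0 < d & forall r, t0 <= r < s -> s - d < r -> y s <= y r + e.
  move=> ts e e0.
  have [d d0 dP] := LF_left_continuous t00 uPC ts (stm x0 s t00 uPC) e0.
  exists d => // r rs sr.
  by have := dP r rs sr; rewrite ltr_norml => /andP[_]; rewrite /y; lra.
have y_rate s : t0 <= s -> L <= y s ->
    - eta `|x s| + chi `|u s| <= - eta' `|x s|.
  move=> ts Ls; have /andP[_ a2x] := V_bounds (x s) (le_trans t00 ts).
  have rhox : rho N <= `|x s|.
    by apply: (class_K_leI a2K) => //; exact: le_trans a2x.
  have := gain N _ N0 rhox.
  have : chi `|u s| <= chi N.
    by apply: class_K_le => //; apply: PC_ler_norm => //; exact: le_trans ts.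
  lra.
(* The sign of the rate is unknown where [y] is below [L], so monotonicity is first proved for the
   maximum of [y] and [L]. *)
have w_mono r s : t0 <= r <= s -> Num.max (y s) L <= Num.max (y r) L.
  move=> /andP[tr rs]; rewrite -[leRHS]addr0 -[in leRHS](mul0r (s - r)).
  apply: (dini_decay (w := fun s => Num.max (y s) L)) => //.
    move=> q /andP[rq qs] e e0.
    have [d d0 dP] := y_left q (le_lt_trans tr rq) e e0.
    exists d => // v /andP[rv vq] qv; have := dP v.
    rewrite vq (le_trans tr rv) => /(_ isT qv) yq.
    have : y v <= Num.max (y v) L by rewrite le_max lexx.
    have : L <= Num.max (y v) L by rewrite le_max lexx orbT.
    by move=> ? ?; rewrite ge_max; apply/andP; split; lra.
  move=> q /andP[rq qs]; have tq := le_trans tr rq.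
  apply: dini_ub_max (y_dini q tq) _ => Lq; apply: le_trans (y_rate q tq Lq) _.
  by rewrite oppr_le0; exact: class_P_ge0.
(* As [y t > L], a value [y s] below [y t] would make the maximum increase between [s] and [t]. *)
have y_ge s : t0 <= s <= t -> y t <= y s.
  by move=> /w_mono; rewrite (max_l (ltW Ly)) le_max [y t <= L]leNgt Ly orbF.
have y_le s : t0 <= s <= t -> y s <= y t0.
  move=> /andP[ts st]; have := w_mono t0 s; rewrite lexx ts => /(_ isT).
  rewrite ge_max => /andP[+ _]; rewrite le_max => /orP[//|].
  by have := y_ge s; rewrite ts st => /(_ isT); lra.
have yt0 : y t0 <= a2 `|x0|.
  by have /andP[_] := V_bounds (x t0) t00; rewrite /y /x xt0.
have yt_ge0 : 0 <= y t := ltW (le_lt_trans L0 Ly).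
have [p0 pE] := g2E _ yt_ge0; set p := g2 (y t) in p0 pE.
rewrite -pE; apply: class_K_le => //; apply: Bmax => //; rewrite pE.
suff : y t <= y t0 + - band_inf eta' p (g1 (a2 `|x0|)) * (t - t0).
  by rewrite (mulrC (t - t0)); lra.
apply: dini_decay => //.
  by move=> s /andP[ts _]; exact: y_left.
move=> s /andP[ts st]; have Is : t0 <= s <= t by rewrite ts ltW.
apply: dini_ub_le (y_dini s ts).
apply: le_trans (y_rate s ts _) _.
  by apply: ltW; apply: lt_le_trans Ly (y_ge s Is).
rewrite lerN2; apply: band_inf_le => //.
have /andP[a1x a2x] := V_bounds (x s) (le_trans t00 ts).
apply/andP; split.
  apply: (class_K_leI a2K) => //; rewrite pE; exact: le_trans (y_ge s Is) a2x.
have [g10 g1c] := g1E _ (class_K_ge0 a2K (normr_ge0 x0)).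
apply: (class_K_leI a1K g10); rewrite g1c; apply: (le_trans a1x).
exact: le_trans (y_le s Is) yt0.
Qed.

End Trajectories.

Theorem mainTheorem4 (R : realType) (U X : normedModType R)
  (phi : R -> R -> X -> (R -> U) -> X) (tm : R -> X -> (R -> U) -> \bar R) :
  control_system phi tm -> BIC phi tm ->
  (has_coercive_iISS_LF phi -> forward_complete phi tm /\ iISS phi tm) /\
  (has_coercive_ISS_LF_dissipative phi -> ISS phi tm).
Proof.
move=> CS bic; split=> [[V [a1 [a2 [eta [chi LF]]]]]|].
  have FC := LF_forward_complete CS LF bic.
  by split=> //; exact: LF_iISS CS LF FC.
move=> [V [a1 [a2 [eta [chi [LF Heta]]]]]].
have FC := LF_forward_complete CS LF bic.
have [_ [_ [_ [_ [_ [etaP [chiK _]]]]]]] := LF.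
have [rho [eta' [rhoK eta'P gain]]] :=
  dissipation_gain etaP chiK (dissipation_gap chiK Heta).
exact (LF_ISS CS LF FC rhoK eta'P gain).
Qed.
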